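(* Let $r\ge 1$, let $A$ be a real $r\times r$ matrix and let $R,S$ be real symmetric positive semi-definite $r\times r$ matrices such that $(A,R^{1/2})$ is controllable and $(A,S^{1/2})$ is observable. Then for any symmetric positive definite $r\times r$ matrices $P,Q$ and any integer $n\geq 1$, $$\mathcal{H}\left(P,\widehat{\Phi}_n(Q)\right)=\mathcal{E}_n(P)^{\prime}\,\mathcal{H}\left(\Phi_n(P),Q\right)\,\mathcal{E}_n(P)+\mathcal{G}_n(P).$$
   Context: All matrices are real $r\times r$; $M'$ denotes the transpose of $M$. $\mathcal{S}^0_r$ and $\mathcal{S}^+_r$ are the sets of symmetric positive semi-definite, respectively positive definite, matrices. $R^{1/2}$, $S^{1/2}$ are symmetric square roots of $R,S$. Controllability of $(A,R^{1/2})$ means that $[R^{1/2},AR^{1/2},\ldots,A^{r-1}R^{1/2}]$ has rank $r$; observability of $(A,S^{1/2})$ means that the matrix obtained by stacking $S^{1/2},S^{1/2}A,\ldots,S^{1/2}A^{r-1}$ vertically has rank $r$. For $P,Q\in\mathcal{S}^0_r$ the matrix $I+PQ$ is invertible. The Riccati maps $\Phi,\widehat\Phi:\mathcal{S}^0_r\to\mathcal{S}^0_r$ are $$\Phi(P):=A(I+PS)^{-1}PA'+R,\qquad \widehat\Phi(P):=A'(I+PR)^{-1}PA+S,$$ and $\Phi_n,\widehat\Phi_n$ are their $n$-fold compositions ($\Phi_0=\widehat\Phi_0=$ identity map). Under the stated controllability and observability conditions, $\Phi_n(P)$ and $\widehat\Phi_n(P)$ are positive definite whenever $P$ is. For $P\in\mathcal{S}^0_r$: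 $\mathcal{E}(P):=A(I+PS)^{-1}$, $\mathcal{F}(P):=S(I+PS)^{-1}\in\mathcal{S}^0_r$. The matrices $\mathcal{E}_n(P)$ are defined by $\mathcal{E}_0(P)=I$, $\mathcal{E}_{n+1}(P)=\mathcal{E}_n(\Phi(P))\,\mathcal{E}(P)$. The matrices $\mathcal{G}_n(P)$ are defined by $\mathcal{G}_0(P)=0$ and $\mathcal{G}_n(P)=\mathcal{F}(P)+\mathcal{E}(P)'\,\mathcal{G}_{n-1}(\Phi(P))\,\mathcal{E}(P)$ for $n\ge1$. For $P,Q\in\mathcal{S}^+_r$: $\mathcal{H}(P,Q):=(P+Q^{-1})^{-1}\in\mathcal{S}^+_r$. *)

(* Defs.v *)
From mathcomp Require Import all_boot all_order all_algebra.
From mathcomp Require Export reals.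

Set Implicit Arguments.
Unset Strict Implicit.
Unset Printing Implicit Defensive.

Import Order.TTheory GRing.Theory Num.Theory.
Local Open Scope ring_scope.

Section Riccati.
Variables (K : realType) (r : nat).
Implicit Types A R S M N P Q : 'M[K]_r.

Definition possemidef M : Prop :=
  M^T = M /\ forall x : 'cV[K]_r, 0 <= (x^T *m M *m x) 0 0.

Definition posdef M : Prop :=
  M^T = M /\ forall x : 'cV[K]_r, x != 0 -> 0 < (x^T *m M *m x) 0 0.

(* A symmetric square root is not required to be positive semi-definite. *)
Definition symmetric_sqrt M N : Prop := N^T = N /\ N *m N = M.

Definition controllable A N : Prop :=
  \rank (\mxrow_(i < r) (A ^+ i *m N)) = r.

Definition observable A N : Prop :=
  \rank (\mxcol_(i < r) (N *m A ^+ i)) = r.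

(* invmx is total: it returns its argument on a singular matrix.  Below it is
   only meaningful where its argument is invertible, which is the case for
   1 + P *m S with P and S positive semi-definite. *)
Definition Phi A R S P : 'M[K]_r :=
  A *m invmx (1%:M + P *m S) *m P *m A^T + R.

Definition Phihat A R S P : 'M[K]_r :=
  A^T *m invmx (1%:M + P *m R) *m P *m A + S.

Definition Phin A R S n P : 'M[K]_r := iter n (Phi A R S) P.

Definition Phihatn A R S n P : 'M[K]_r := iter n (Phihat A R S) P.

Definition Emap A S P : 'M[K]_r := A *m invmx (1%:M + P *m S).

Definition Fmap S P : 'M[K]_r := S *m invmx (1%:M + P *m S).

Fixpoint En A R S n P : 'M[K]_r :=
  if n is m.+1 then En A R S m (Phi A R S P) *m Emap A S P else 1%:M.

Fixpoint Gn A R S n P : 'M[K]_r :=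
  if n is m.+1 then
    Fmap S P + (Emap A S P)^T *m Gn A R S m (Phi A R S P) *m Emap A S P
  else 0.

Definition Hmap P Q : 'M[K]_r := invmx (P + invmx Q).

End Riccati.

(* Main.v *)
Require Import Defs.
From mathcomp Require Import all_boot all_order all_algebra reals.
Local Open Scope ring_scope.

(** The map [H] intertwines the two recursions in one step:
    [H(P, Phihat Q) = E(P)' H(Phi P, Q) E(P) + F(P)], and the theorem is the
    [n]-fold iterate of this identity. Put [V = (P^-1 + S)^-1] and
    [U = (Q^-1 + R)^-1], so that [Phi P = A V A' + R] and
    [Phihat Q = A' U A + S]. Applying the Woodbury formula twice,
    [(P + (Phihat Q)^-1)^-1 = P^-1 - P^-1 (V^-1 + A' U A)^-1 P^-1] and
    [(V^-1 + A' U A)^-1 = V - V A' (Phi P + Q^-1)^-1 A V]; it remains to note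
    that [E(P) = A V P^-1] and [F(P) = P^-1 - P^-1 V P^-1]. Controllability and
    observability keep all the iterates positive definite, hence invertible. *)

Import Order.TTheory GRing.Theory Num.Theory.

Lemma mulmx1_invmx (F : fieldType) (n : nat) (M N : 'M[F]_n) :
  M *m N = 1%:M -> invmx M = N.
Proof.
move=> MN; have [uM _] := mulmx1_unit MN.
by rewrite -[LHS]mulmx1 -MN mulKmx.
Qed.

(** The right-hand side is checked to be a right inverse. With [W] the matrix
    [invmx U + C *m V *m B], the cross terms cancel because [U (W - U^-1) W^-1 = U - W^-1]. *)
Lemma woodbury (F : fieldType) (m n : nat) (V : 'M[F]_n) (U : 'M[F]_m)
    (B : 'M[F]_(n, m)) (C : 'M[F]_(m, n)) :
  V \in unitmx -> U \in unitmx -> invmx U + C *m V *m B \in unitmx ->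
  invmx (invmx V + B *m U *m C) =
    V - V *m B *m invmx (invmx U + C *m V *m B) *m C *m V.
Proof.
move=> uV uU; set W := _ + _ => uW; apply: mulmx1_invmx.
have key : U *m (C *m V *m B) *m invmx W = U - invmx W.
  have -> : C *m V *m B = W - invmx U by rewrite /W [invmx U + _]addrC addrK.
  by rewrite mulmxBr mulmxBl mulmxK // mulmxV // mul1mx.
rewrite mulmxDl !mulmxBr !mulmxA mulVmx // mul1mx.
have -> : B *m U *m C *m V *m B *m invmx W = B *m (U - invmx W).
  by rewrite -key !mulmxA.
by rewrite mulmxBr !mulmxBl opprB subrKC subrK.
Qed.

Section Definiteness.
Set Implicit Arguments.
Unset Strict Implicit.
Variables (K : realType) (r : nat).
Implicit Types A M N P Q R S V : 'M[K]_r.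

Lemma gram_ge0 (x : 'cV[K]_r) : 0 <= (x^T *m x) 0 0.
Proof. by rewrite mxE sumr_ge0 // => i _; rewrite mxE -expr2 sqr_ge0. Qed.

Lemma gram_gt0 (x : 'cV[K]_r) : x != 0 -> 0 < (x^T *m x) 0 0.
Proof.
move=> x0; rewrite lt_neqAle gram_ge0 andbT eq_sym; apply: contraNneq x0.
rewrite mxE => /eqP; rewrite psumr_eq0 => [/allP x0|i _]; last first.
  by rewrite mxE -expr2 sqr_ge0.
apply/eqP/colP => i; rewrite [RHS]mxE.
by have := x0 i (mem_index_enum i); rewrite mxE -expr2 sqrf_eq0 => /eqP.
Qed.

Lemma posdef_unit M : posdef M -> M \in unitmx.
Proof.
case=> _ pM; rewrite -row_free_unit -kermx_eq0; apply/rowV0P => u /sub_kermxP.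
move=> uM; apply/eqP; apply: contraT => u0; have := pM u^T.
by rewrite trmx_eq0 u0 trmxK uM mul0mx mxE ltxx => /(_ isT).
Qed.

Lemma posdef_possemidef M : posdef M -> possemidef M.
Proof.
case=> tM pM; split=> // x; have [->|/pM /ltW //] := eqVneq x 0.
by rewrite mulmx0 mxE.
Qed.

Lemma posdef_inv M : posdef M -> posdef (invmx M).
Proof.
move=> dM; have uM := posdef_unit dM; case: dM => tM pM.
have tMi : (invmx M)^T = invmx M by rewrite trmx_inv tM.
(* With [y = M^-1 x], the form [x' M^-1 x] equals [y' M y]. *)
split=> // x x0; have := pM (invmx M *m x).
rewrite trmx_mul tMi !mulmxA mulmxKV //; apply.
by apply: contraNneq x0 => /(congr1 (mulmx M)); rewrite mulKVmx // mulmx0 => ->.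
Qed.

Lemma posdefDr M N : posdef M -> possemidef N -> posdef (M + N).
Proof.
move=> [tM pM] [tN pN]; split=> [|x x0]; first by rewrite linearD /= tM tN.
by rewrite mulmxDr mulmxDl mxE ltr_pwDl ?pM ?pN.
Qed.

Lemma congr_possemidef A M : possemidef M -> possemidef (A^T *m M *m A).
Proof.
move=> [tM pM]; split=> [|x]; first by rewrite !trmx_mul trmxK tM mulmxA.
by have := pM (A *m x); rewrite trmx_mul !mulmxA.
Qed.

(** The quadratic form at [x] is [(A x)' V (A x) + |N x|^2], a sum of two nonnegative terms. The
    first is positive unless [A x = 0], and in that case [N x] is nonzero. *)
Lemma posdef_congrD A S N V : posdef V -> possemidef S -> symmetric_sqrt S N ->
  (forall x : 'cV[K]_r, A *m x = 0 -> N *m x = 0 -> x = 0) ->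
  posdef (A^T *m V *m A + S).
Proof.
move=> dV [tS pS] [tN NN] ker0.
have [tC pC] := congr_possemidef A (posdef_possemidef dV).
split=> [|x x0]; first by rewrite linearD /= tC tS.
rewrite mulmxDr mulmxDl mxE; have [Ax|Ax] := eqVneq (A *m x) 0.
  apply: ltr_wpDl => //; rewrite -NN -{1}tN !mulmxA -mulmxA -trmx_mul.
  by apply: gram_gt0; apply: contraNneq x0 => /(ker0 x Ax) ->.
apply: ltr_pwDl => //; have [_ /(_ _ Ax)] := dV.
by rewrite trmx_mul !mulmxA.
Qed.

(** From [I + P S = P (P^-1 + S)]. This replaces the non-symmetric resolvent in the Riccati maps by
    the inverse of a symmetric matrix. *)
Lemma invmx_resolvent P S : P \in unitmx -> invmx P + S \in unitmx ->
  invmx (1%:M + P *m S) *m P = invmx (invmx P + S).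
Proof.
move=> uP uPS; have -> : 1%:M + P *m S = P *m (invmx P + S).
  by rewrite mulmxDr mulmxV.
have -> : invmx (P *m (invmx P + S)) = invmx (invmx P + S) *m invmx P.
  apply: mulmx1_invmx; rewrite mulmxA -(mulmxA P).
  by rewrite mulmxV // mulmx1 mulmxV.
by rewrite mulmxKV.
Qed.

Lemma Phihat_posdef A R S N Q : posdef Q -> possemidef R -> possemidef S ->
  symmetric_sqrt S N ->
  (forall x : 'cV[K]_r, A *m x = 0 -> N *m x = 0 -> x = 0) ->
  posdef (Phihat A R S Q).
Proof.
move=> dQ dR dS sN ker0; have dU := posdefDr (posdef_inv dQ) dR.
rewrite /Phihat -(mulmxA A^T) invmx_resolvent ?posdef_unit //.
by apply: posdef_congrD ker0 => //; apply: posdef_inv.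
Qed.

(** Duality: positivity of [Phi] follows from that of [Phihat] for the transposed system. *)
Lemma Phi_Phihat A R S P : Phi A R S P = Phihat A^T S R P.
Proof. by rewrite /Phihat trmxK. Qed.

(** Full column rank gives the observability matrix a left inverse [B]. A vector killed by both [A]
    and [N] is killed by every block [N A^i]: by [N] when [i = 0], by [A] otherwise. *)
Lemma observable_ker A N : observable A N ->
  forall x : 'cV[K]_r, A *m x = 0 -> N *m x = 0 -> x = 0.
Proof.
move=> rk x Ax Nx.
have /row_fullP[B BO] : row_full (\mxcol_(i < r) (N *m A ^+ i)) by apply/eqP.
rewrite -[x]mul1mx -BO -mulmxA mxcol_mul.
suff -> : \mxcol_(i < r) (N *m A ^+ i *m x) = 0 by rewrite mulmx0.
apply/eqP; rewrite -mxcol0; apply/eqP/eq_mxcol => -[[|i] _] /=.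
  by rewrite expr0 mulmx1.
by rewrite exprSr -mulmxA -[_ * _]/(_ *m _) -mulmxA Ax !mulmx0.
Qed.

Lemma controllable_observable A N : N^T = N ->
  controllable A N -> observable A^T N.
Proof.
move=> tN; rewrite /observable /controllable -mxrank_tr tr_mxrow.
apply: etrans; congr (\rank _); apply: eq_mxcol => i; rewrite trmx_mul tN.
congr (_ *m _).
elim: (i : nat) => [|k IH]; first by rewrite !expr0 trmx1.
by rewrite exprSr exprS -[LHS]/(_ *m _) IH -trmx_mul.
Qed.

Lemma Hmap_Phihat A R S P Q : possemidef R -> possemidef S ->
  posdef P -> posdef Q -> posdef (Phihat A R S Q) ->
  Hmap P (Phihat A R S Q) =
    (Emap A S P)^T *m Hmap (Phi A R S P) Q *m Emap A S P + Fmap S P.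
Proof.
move=> dR dS dP dQ dT.
have [uP uQ] := (posdef_unit dP, posdef_unit dQ); have [tP _] := dP.
have dPS := posdefDr (posdef_inv dP) dS.
have dQR := posdefDr (posdef_inv dQ) dR.
have dV := posdef_inv dPS; have dU := posdef_inv dQR.
have [uPS uQR] := (posdef_unit dPS, posdef_unit dQR).
have [uV uU] := (posdef_unit dV, posdef_unit dU).
set V := invmx (invmx P + S) in dV uV; set U := invmx (invmx Q + R) in dU uU.
have VE : invmx (1%:M + P *m S) = V *m invmx P.
  by rewrite /V -invmx_resolvent // mulmxK.
have PhiE : Phi A R S P = A *m V *m A^T + R by rewrite /Phi VE !mulmxA mulmxKV.
have PhihatE : Phihat A R S Q = A^T *m U *m A + S.
  by rewrite /Phihat -(mulmxA A^T) invmx_resolvent.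
have EE : Emap A S P = A *m V *m invmx P by rewrite /Emap VE mulmxA.
have ETE : (Emap A S P)^T = invmx P *m V *m A^T.
  by rewrite EE !trmx_mul trmx_inv tP (proj1 dV) mulmxA.
have FE : Fmap S P = invmx P - invmx P *m V *m invmx P.
  (* Only the first [P^-1] is expanded, so that the subtraction leaves [S V P^-1]. *)
  have {1}-> : invmx P = (invmx P + S) *m V *m invmx P.
    by rewrite mulmxV // mul1mx.
  by rewrite /Fmap VE !mulmxDl [X in X - _]addrC addrK mulmxA.
have VK : invmx V = invmx P + S by rewrite invmxK.
have HE : Hmap (Phi A R S P) Q = invmx (invmx U + A *m V *m A^T).
  by rewrite /Hmap PhiE invmxK -addrA addrC (addrC R).
have uW : invmx U + A *m V *m A^T \in unitmx.
  apply/posdef_unit/posdefDr; first exact: posdef_inv.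
  by rewrite -{1}(trmxK A); apply/congr_possemidef/posdef_possemidef.
have uPT : invmx P + Phihat A R S Q \in unitmx.
  exact/posdef_unit/(posdefDr (posdef_inv dP))/posdef_possemidef.
(* First use of Woodbury, around [P], with [B = C = I] and the inverse of [Phihat Q] in the role of
   [U]. *)
have -> : Hmap P (Phihat A R S Q) =
    invmx P - invmx P *m invmx (invmx P + Phihat A R S Q) *m invmx P.
  have uT := posdef_unit dT; set T := Phihat A R S Q in uT uPT *.
  have := @woodbury _ _ _ (invmx P) (invmx T) 1%:M 1%:M.
  rewrite /Hmap !mul1mx !mulmx1 !unitmx_inv !invmxK => -> //;
    by rewrite (addrC T).
have -> : invmx P + Phihat A R S Q = invmx V + A^T *m U *m A.
  by rewrite PhihatE VK addrA addrAC.
(* Second use, with [B = A'] and [C = A]. The term [P^-1 - P^-1 V P^-1] is [F(P)], and the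
   correction term is the conjugate of [H(Phi P, Q)] by [E(P)]. *)
rewrite woodbury // HE ETE EE FE mulmxBr mulmxBl opprB !mulmxA.
by rewrite addrCA.
Qed.

End Definiteness.

Theorem theorem1p1 (K : realType) (r : nat) (hr : (1 <= r)%N)
    (A R S Rhalf Shalf : 'M[K]_r)
    (hR : possemidef R) (hS : possemidef S)
    (hRhalf : symmetric_sqrt R Rhalf) (hShalf : symmetric_sqrt S Shalf)
    (hctrl : controllable A Rhalf) (hobs : observable A Shalf)
    (P Q : 'M[K]_r) (hP : posdef P) (hQ : posdef Q)
    (n : nat) (hn : (1 <= n)%N) :
  Hmap P (Phihatn A R S n Q) =
    (En A R S n P)^T *m Hmap (Phin A R S n P) Q *m En A R S n P + Gn A R S n P.
Proof.
have kerA := observable_ker hobs.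
have kerAT :=
  observable_ker (controllable_observable (proj1 hRhalf) hctrl).
have dPhi M : posdef M -> posdef (Phi A R S M).
  by move=> dM; rewrite Phi_Phihat; apply: Phihat_posdef kerAT.
have dPhihat M : posdef M -> posdef (Phihat A R S M).
  by move=> dM; apply: Phihat_posdef kerA.
have dPhihatn k : posdef (Phihatn A R S k Q).
  by elim: k => //= k IH; apply: dPhihat.
(* [P] is generalized because the induction hypothesis is needed at [Phi P]; [Q] stays fixed. The
   induction starts at [n = 0], where [E_0 = I] and [G_0 = 0]. *)
elim: n P hP {hn} => [|n IH] P hP.
  by rewrite /= trmx1 mul1mx mulmx1 addr0.
(* [Phihatn] is peeled from the outside, for the one-step identity at the [n]-th iterate of [Q];
   [Phin] is peeled from the inside, as in the recursions for [En] and [Gn]. *)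
rewrite [Phihatn _ _ _ _ _]iterS -/(Phihatn A R S n Q).
rewrite Hmap_Phihat //; last exact: dPhihat.
rewrite IH; last exact: dPhi.
rewrite [Phin _ _ _ n.+1 _]iterSr -/(Phin A R S n _) /=.
rewrite (trmx_mul (En _ _ _ _ _)).
by rewrite mulmxDr mulmxDl !mulmxA -addrA (addrC (Fmap S P)).
Qed.
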